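(* Let $k \geq 2$ be an even integer and let $q$ be a prime power such that $q \equiv k+1 \pmod{2k}$. Let $i \in \{1,2,\ldots,\frac{k}{2}\}$ and let $v \in V(M_k(q))$. Then the induced subgraph of $M_k(q)$ with vertex set $\mathrm{ON}_i(v)$ is isomorphic, as an edge-colored digraph, to $P_k(q)$.
   Context: Let $\mathbb{F}_q$ be the finite field with $q$ elements, $\omega$ a fixed primitive element of $\mathbb{F}_q$, and $S_k = \langle \omega^k \rangle$ the subgroup of $\mathbb{F}_q^{\ast}$ of order $\frac{q-1}{k}$ consisting of the $k$-th power residues. Put $S_{k,0} := \{0\}$ and $S_{k,i} := \omega^{i-1} S_k$ for $1 \leq i \leq \frac{k}{2}$. Since $q \equiv k+1 \pmod{2k}$, one has $-S_{k,i} = \omega^{k/2} S_{k,i}$ for $1 \le i \le \frac{k}{2}$, and $\mathbb{F}_q$ is the disjoint union of $S_{k,0}$, the sets $S_{k,i}$ and the sets $-S_{k,i}$, $1 \leq i \leq \frac{k}{2}$. Let $X := (\mathbb{F}_q \times \mathbb{F}_q) \setminus \{(0,0)\}$, with the equivalence relation $(a,b) \sim (c,d)$ iff $(c,d) = (ag,bg)$ for some $g \in S_k$; write $[a,b]$ for the class of $(a,b)$. $M_k(q)$ is the edge-colored digraph (without loops) with vertex set $X/\sim$, in which, for distinct vertices, $[a,b] \to [c,d]$ is an edge in color $i$, $0 \leq i \leq \frac{k}{2}$, if and only if $bc - ad \in S_{k,i}$. (This is well defined. Any two distinct vertices are either connected by a single oriented edge in some color $i$ with $1 \leq i \leq \frac{k}{2}$,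 or connected by two edges of color $0$ oriented in opposite directions.) $V(M_k(q))$ is its vertex set, and $\mathrm{ON}_i(v)$ is the set of vertices $w$ such that $v \to w$ is an edge of color $i$. The multicolor $k$-th power Paley tournament $P_k(q)$ is the tournament with vertex set $\mathbb{F}_q$ whose edges are colored in $\frac{k}{2}$ colors: $a \to b$ is an edge of color $i$ ($1 \leq i \leq \frac{k}{2}$) if and only if $b - a \in S_{k,i}$. An isomorphism of edge-colored digraphs is a bijection of vertex sets preserving edges, their orientations and their colors. *)

(* Defs.v *)
From HB Require Import structures.
From mathcomp Require Import all_boot all_order all_algebra all_fingroup all_solvable.

Set Implicit Arguments.
Unset Strict Implicit.
Unset Printing Implicit Defensive.

Import GRing.Theory.
Local Open Scope ring_scope.

(* A color class is an arbitrary relation: edges of different colors, or in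
   both directions, may coexist between two vertices. *)
Record colored_digraph (C : Type) := ColoredDigraph {
  vertex : finType;
  edge : C -> rel vertex
}.

Definition induced_subgraph (C : Type) (G : colored_digraph C)
    (A : {set vertex G}) : colored_digraph C :=
  @ColoredDigraph C {x : vertex G | x \in A}
    (fun c x y => edge c (val x) (val y)).

Definition out_neighbors (C : Type) (G : colored_digraph C) (c : C)
    (v : vertex G) : {set vertex G} :=
  [set w | edge c v w].

Definition isomorphic (C : Type) (G H : colored_digraph C) : Prop :=
  exists f : vertex G -> vertex H,
    bijective f /\ forall c x y, edge c (f x) (f y) = edge c x y.

(* The colors 0, ..., k/2. *)
Notation color k := 'I_(k./2).+1.

Definition power_residues (F : finFieldType) (omega : {unit F}) (k : nat) :
    {set F} :=
  [set val u | u in <[(omega ^+ k)%g]>%g].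

Definition residue_class (F : finFieldType) (omega : {unit F}) (k i : nat) :
    {set F} :=
  if i is j.+1 then
    [set val omega ^+ j * s | s in power_residues omega k]
  else [set 0].

Definition scaling_rel (F : finFieldType) (omega : {unit F}) (k : nat) :
    rel (F * F) :=
  fun x y => [exists g in power_residues omega k, y == (x.1 * g, x.2 * g)].

Definition M_vertices (F : finFieldType) (omega : {unit F}) (k : nat) :
    {set {set F * F}} :=
  equivalence_partition (scaling_rel omega k) [set~ (0, 0)].

(* The condition does not depend on the chosen representatives:
   see M_edgeE below. *)
Definition M (F : finFieldType) (omega : {unit F}) (k : nat) :
    colored_digraph (color k) :=
  @ColoredDigraph (color k) {v : {set F * F} | v \in M_vertices omega k}
    (fun i v w => (v != w) &&
      [exists x in val v, exists y in val w,
         x.2 * y.1 - x.1 * y.2 \in residue_class omega k i]).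

(* Color 0 is included so that the Paley tournament has the same set of colors
   as M; no edge has that color. *)
Definition paley (F : finFieldType) (omega : {unit F}) (k : nat) :
    colored_digraph (color k) :=
  @ColoredDigraph (color k) F
    (fun i a b => (0 < i)%N && (b - a \in residue_class omega k i)).

Lemma power_residuesM (F : finFieldType) (omega : {unit F}) (k : nat) (g h : F) :
  g \in power_residues omega k -> h \in power_residues omega k ->
  g * h \in power_residues omega k.
Proof.
move=> /imsetP[u hu ->] /imsetP[w hw ->].
by apply/imsetP; exists (u * w)%g; rewrite ?groupM.
Qed.

Lemma power_residuesV (F : finFieldType) (omega : {unit F}) (k : nat) (g : F) :
  g \in power_residues omega k -> g^-1 \in power_residues omega k.
Proof.
move=> /imsetP[u hu ->].
by apply/imsetP; exists (u^-1)%g; rewrite ?groupV // -FinRing.val_unitV.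
Qed.

Lemma power_residues_neq0 (F : finFieldType) (omega : {unit F}) (k : nat) (g : F) :
  g \in power_residues omega k -> g != 0.
Proof. by move=> /imsetP[u _ ->]; rewrite -unitfE; exact: (valP u). Qed.

Lemma scaling_rel_equiv (F : finFieldType) (omega : {unit F}) (k : nat) :
  equivalence_rel (scaling_rel omega k).
Proof.
have sym x y : scaling_rel omega k x y -> scaling_rel omega k y x.
  move=> /existsP[g /andP[hg /eqP ->]] /=.
  apply/existsP; exists g^-1; rewrite power_residuesV //=.
  by rewrite !mulfK ?(power_residues_neq0 hg) // -surjective_pairing.
have trans x y z :
    scaling_rel omega k x y -> scaling_rel omega k y z -> scaling_rel omega k x z.
  move=> /existsP[g /andP[hg /eqP ->]] /existsP[h /andP[hh /eqP ->]] /=.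
  by apply/existsP; exists (g * h); rewrite power_residuesM //= !mulrA.
move=> x y z; split=> [|hxy].
  apply/existsP; exists 1; rewrite !mulr1 -surjective_pairing eqxx andbT.
  by apply/imsetP; exists 1%g; rewrite ?group1.
by apply/idP/idP; apply: trans => //; exact: sym.
Qed.

Lemma residue_classM (F : finFieldType) (omega : {unit F}) (k i : nat) (g x : F) :
  g \in power_residues omega k -> x \in residue_class omega k i ->
  x * g \in residue_class omega k i.
Proof.
move=> hg; case: i => [|j] /=; first by rewrite !inE => /eqP ->; rewrite mul0r.
move=> /imsetP[s hs ->]; apply/imsetP; exists (s * g); rewrite ?mulrA //.
exact: power_residuesM.
Qed.

Lemma M_vertex_rel (F : finFieldType) (omega : {unit F}) (k : nat)
    (v : vertex (M omega k)) (x y : F * F) :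
  x \in val v -> y \in val v -> scaling_rel omega k x y.
Proof.
case: v => v /= /imsetP[z _ ->]; rewrite !inE => /andP[_ hx] /andP[_ hy].
by have [_ <-] := scaling_rel_equiv omega k z x y.
Qed.

Lemma M_edgeE (F : finFieldType) (omega : {unit F}) (k : nat) (i : color k)
    (v w : vertex (M omega k)) (x y : F * F) :
  x \in val v -> y \in val w ->
  edge i v w =
    (v != w) && (x.2 * y.1 - x.1 * y.2 \in residue_class omega k i).
Proof.
move=> hx hy /=; congr (_ && _); apply/idP/idP; last first.
  move=> h; apply/existsP; exists x; rewrite hx /=.
  by apply/existsP; exists y; rewrite hy.
move=> /existsP[x' /andP[hx' /existsP[y' /andP[hy' h]]]].
have /existsP[g /andP[hg /eqP ->]] := M_vertex_rel hx' hx.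
have /existsP[g' /andP[hg' /eqP ->]] := M_vertex_rel hy' hy.
move: h => /(residue_classM hg) /(residue_classM hg') /=.
by rewrite -mulrA mulrBl ![_ * _ * (g * g')]mulrACA.
Qed.

(* Main.v *)
Require Import Defs.
From mathcomp Require Import all_boot all_order all_algebra all_fingroup all_solvable.
From mathcomp Require Import ring.

(** The edges of [M omega k] are governed by the symplectic form
    [B(x, y) = x.2 * y.1 - x.1 * y.2] on the plane [F * F].  Fix a representative
    [x] of [v] and put [t := omega ^+ i.-1].  A vertex [w] is an [i]-out-neighbor
    of [v] exactly when [B(x, y)] lies in [t] times the group of power residues
    for the representatives [y] of [w]; since scaling [y] by [g] scales [B(x, y)]
    by [g], such a [w] has exactly one representative on the affine line
    [B(x, y) = t].  So the out-neighbors are parametrized by that line, which is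
    a translate of [F x].

    Choose a base point [p] on the line and parametrize it by
    [s |-> line_point x p s = p - (s / t) x].  The speed is chosen so that the
    form, evaluated at two points of the line, is the difference of their
    parameters ([symp_line]): the edges between out-neighbors are therefore
    those of the Paley tournament.  That every point of the line is
    reached is the three-term relation
    [B(x, p) y = B(x, y) p - B(p, y) x] in the plane ([line_pointE]).
    The case of color 0 matches too: two points of the line where the form
    vanishes have the same parameter, hence are not distinct vertices. *)

Section OutNeighborsOfM.
Set Implicit Arguments.
Unset Strict Implicit.
Import GRing.Theory.
Local Open Scope ring_scope.

Definition symp (F : fieldType) (x y : F * F) : F := x.2 * y.1 - x.1 * y.2.

Definition line_point (F : fieldType) (x p : F * F) (s : F) : F * F :=
  (p.1 - s / symp x p * x.1, p.2 - s / symp x p * x.2).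

Lemma symp_surj (F : fieldType) (x : F * F) (t : F) :
  x != (0, 0) -> exists p, symp x p = t.
Proof.
case: x => a b; rewrite /symp xpair_eqE /= negb_and.
have [-> /= b0|a0 _] := eqVneq a 0.
  by exists (t / b, 0) => /=; field.
by exists (0, - t / a) => /=; field.
Qed.

Lemma symp_line_l (F : fieldType) (x p : F * F) (s : F) :
  symp x (line_point x p s) = symp x p.
Proof. by rewrite /line_point; move: (s / _) => r; rewrite /symp /=; ring. Qed.

(** Expanding bilinearly, only the two cross terms survive, and the division by
    [symp x p] in [line_point] cancels their common factor. *)
Lemma symp_line (F : fieldType) (x p : F * F) (s s' : F) :
  symp x p != 0 -> symp (line_point x p s) (line_point x p s') = s' - s.
Proof.
move=> t0.
transitivity ((s' / symp x p - s / symp x p) * symp x p).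
  rewrite /line_point; move: (s / _) (s' / _) => r r'.
  by rewrite /symp /=; ring.
by rewrite mulrBl !divfK.
Qed.

(** Three vectors of a plane are dependent, with coefficients given by the form;
    solving this relation for [y] shows that the level line of [symp x] through
    [p] is covered by [line_point], and gives the parameter of [y]. *)
Lemma line_pointE (F : fieldType) (x p y : F * F) :
  symp x p != 0 -> symp x y = symp x p -> y = line_point x p (symp p y).
Proof.
move=> t0 eq_t.
have e1 : symp x p * y.1 = symp x y * p.1 - symp p y * x.1.
  by rewrite /symp; ring.
have e2 : symp x p * y.2 = symp x y * p.2 - symp p y * x.2.
  by rewrite /symp; ring.
rewrite eq_t in e1 e2.
rewrite [LHS]surjective_pairing /line_point; congr (_, _); apply: (mulfI t0).
  by rewrite e1 mulrBr mulrA mulrC mulrCA divff // mulr1 (mulrC p.1).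
by rewrite e2 mulrBr mulrA mulrC mulrCA divff // mulr1 (mulrC p.2).
Qed.

Lemma power_residues1 (F : finFieldType) (omega : {unit F}) (k : nat) :
  1 \in power_residues omega k.
Proof. by apply/imsetP; exists 1%g; rewrite ?group1. Qed.

Lemma residue_class_neq0 (F : finFieldType) (omega : {unit F}) (k i : nat)
    (x : F) : (0 < i)%N -> x \in residue_class omega k i -> x != 0.
Proof.
case: i => // j _ /imsetP[s hs ->].
rewrite mulf_neq0 ?(power_residues_neq0 hs) // expf_neq0 // -unitfE.
exact: valP omega.
Qed.

Lemma M_vertex_repr (F : finFieldType) (omega : {unit F}) (k : nat)
    (v : vertex (M omega k)) : exists2 x, x \in val v & x != (0, 0).
Proof.
case: v => v /= /imsetP[x]; rewrite !inE => x0 ->; exists x => //.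
rewrite !inE x0 /=.
by have [] := scaling_rel_equiv omega k x x x.
Qed.

Lemma M_vertex_of (F : finFieldType) (omega : {unit F}) (k : nat) (x : F * F) :
  x != (0, 0) -> exists v : vertex (M omega k), x \in val v.
Proof.
move=> x0.
have hv : [set y in [set~ (0, 0)] | scaling_rel omega k x y]
            \in M_vertices omega k.
  by apply: imset_f; rewrite !inE.
exists (exist (fun A => A \in M_vertices omega k) _ hv); rewrite !inE x0 /=.
by have [] := scaling_rel_equiv omega k x x x.
Qed.

Lemma M_vertex_eq (F : finFieldType) (omega : {unit F}) (k : nat)
    (v w : vertex (M omega k)) (x : F * F) :
  x \in val v -> x \in val w -> v = w.
Proof.
case: v w => [v hv] [w hw] /= xv xw; apply/val_inj => /=.
case/imsetP: hv xv => y _ ->; rewrite !inE => /andP[_ yx].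
case/imsetP: hw xw => z _ ->; rewrite !inE => /andP[_ zx].
apply/setP=> u; rewrite !inE; congr (_ && _).
have [_ /(_ yx) ->] := scaling_rel_equiv omega k y x u.
by have [_ /(_ zx) ->] := scaling_rel_equiv omega k z x u.
Qed.

Lemma M_vertex_scale (F : finFieldType) (omega : {unit F}) (k : nat)
    (v : vertex (M omega k)) (x : F * F) (g : F) :
  g \in power_residues omega k -> x \in val v -> (x.1 * g, x.2 * g) \in val v.
Proof.
move=> hg; case: v => v /= /imsetP[y _ ->].
rewrite !inE => /andP[x0 yx]; apply/andP; split.
  apply: contraNneq x0 => -[/eqP + /eqP].
  rewrite !mulf_eq0 (negPf (power_residues_neq0 hg)) !orbF => /eqP e1 /eqP e2.
  by rewrite [x]surjective_pairing e1 e2.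
have [_ /(_ yx) ->] := scaling_rel_equiv omega k y x (x.1 * g, x.2 * g).
by apply/existsP; exists g; rewrite hg eqxx.
Qed.

(** The representatives [y] of an [i]-out-neighbor of the class of [x] have
    [symp x y] in a single coset of the power residues, so one of them attains
    the distinguished element [omega ^+ i.-1] of that coset. *)
Lemma out_neighbor_repr (F : finFieldType) (omega : {unit F}) (k : nat)
    (i : color k) (v w : vertex (M omega k)) (x : F * F) :
  (0 < i)%N -> x \in val v -> w \in out_neighbors i v ->
  exists2 y, y \in val w & symp x y = val omega ^+ i.-1.
Proof.
move=> i0 xv; rewrite inE; have [y yw _] := M_vertex_repr w.
rewrite (M_edgeE _ xv yw) => /andP[_].
move: i0; case: (nat_of_ord i) => // j _ /imsetP[g hg exy].
exists (y.1 * g^-1, y.2 * g^-1).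
  exact: M_vertex_scale (power_residuesV hg) yw.
by rewrite /symp /= !mulrA -mulrBl exy mulfK ?(power_residues_neq0 hg).
Qed.

Lemma out_neighbor_of (F : finFieldType) (omega : {unit F}) (k : nat)
    (i : color k) (v : vertex (M omega k)) (x y : F * F) :
  (0 < i)%N -> x \in val v -> symp x y = val omega ^+ i.-1 ->
  exists w : {w : vertex (M omega k) | w \in out_neighbors i v},
    y \in val (val w).
Proof.
move=> i0 xv exy.
have hxy : symp x y \in residue_class omega k i.
  rewrite exy; move: i0; case: (nat_of_ord i) => // j _.
  by apply/imsetP; exists 1; rewrite ?mulr1 ?power_residues1.
have xy0 := residue_class_neq0 i0 hxy.
have y0 : y != (0, 0).
  by apply: contraNneq xy0 => ->; rewrite /symp !mulr0 subrr.
have [w yw] := M_vertex_of omega k y0.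
have hw : w \in out_neighbors i v.
  rewrite inE (M_edgeE _ xv yw) hxy andbT.
  apply: contraNneq xy0 => evw; rewrite -evw in yw.
  (* Two representatives of one vertex are proportional. *)
  have /existsP[g /andP[_ /eqP ->]] := M_vertex_rel xv yw.
  by rewrite /symp /=; apply/eqP; ring.
by exists (exist (fun u => u \in out_neighbors i v) w hw).
Qed.

Lemma isomorphic_sym (C : Type) (G H : colored_digraph C) :
  isomorphic G H -> isomorphic H G.
Proof.
move=> [f [[g fK gK] f_edge]]; exists g; split; first by exists f.
by move=> c x y; rewrite -f_edge !gK.
Qed.

Lemma paley_iso_out_neighbors (F : finFieldType) (omega : {unit F}) (k : nat)
    (i : color k) (v : vertex (M omega k)) :
  (0 < i)%N -> isomorphic (paley omega k) (induced_subgraph (out_neighbors i v)).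
Proof.
move=> i0; have [x xv x0] := M_vertex_repr v.
have [p ep] := symp_surj (val omega ^+ i.-1) x0.
have t0 : symp x p != 0.
  by rewrite ep expf_neq0 // -unitfE; exact: valP omega.
have h_ex s : exists w : vertex (induced_subgraph (out_neighbors i v)),
    line_point x p s \in val (val w).
  by apply: out_neighbor_of i0 xv _; rewrite symp_line_l.
have [h hP] := fin_all_exists h_ex.
have h_surj w : exists s, h s = w.
  have [y yw ey] := out_neighbor_repr i0 xv (valP w).
  exists (symp p y); apply/val_inj; apply: (M_vertex_eq (hP _)).
  by rewrite -line_pointE // ey ep.
have h_inj : injective h.
  move=> s s' ehs; have := hP s'; rewrite -ehs => hs'.
  have /existsP[g /andP[_ /eqP eg]] := M_vertex_rel (hP s) hs'.
  (* [symp x] takes the same nonzero value at both points, so the scaling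
     factor between them is 1. *)
  have g1 : g = 1.
    apply: (mulfI t0); rewrite mulr1.
    rewrite -[in RHS](symp_line_l x p s') eg -(symp_line_l x p s).
    by rewrite /symp /= !mulrA mulrBl.
  have := symp_line s s' t0.
  rewrite eg g1 !mulr1 -surjective_pairing /symp mulrC subrr => /esym/eqP.
  by rewrite subr_eq0 => /eqP.
exists h; split.
  have [g gK] := fin_all_exists h_surj.
  by exists g => // s; apply: h_inj; rewrite gK.
move=> c s s'; rewrite [LHS](M_edgeE c (hP s) (hP s')).
rewrite -/(symp _ _) symp_line // [RHS]/=.
rewrite (inj_eq val_inj) (inj_eq h_inj).
case: (posnP c) => [->|c0] /=.
  by rewrite inE subr_eq0 eq_sym andNb.
case hc: (_ \in _); last by rewrite andbF.
by rewrite andbT eq_sym -subr_eq0 (residue_class_neq0 c0 hc).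
Qed.

End OutNeighborsOfM.

Theorem proposition4p1 (k q : nat) (F : finFieldType) (omega : {unit F})
    (hk : (2 <= k)%N) (hk_even : ~~ odd k)
    (hF : #|F| = q) (hq : q = k.+1 %[mod 2 * k])
    (homega : generator [set: {unit F}]%G omega)
    (i : color k) (hi : (1 <= i)%N) (v : vertex (M omega k)) :
  isomorphic (induced_subgraph (out_neighbors i v)) (paley omega k).
Proof. exact/isomorphic_sym/paley_iso_out_neighbors. Qed.
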